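(* Let $n$ be a positive integer, let $A\in K_n$ satisfy $\phi(A)\ge\phi(n^{-1}J_n)$, and let $\delta=\gamma_n-\operatorname{per}(A)$. Assume $\delta<\min\{1/4,\,1/(3n)\}$. Then the matrix $(1-\sqrt{3n\delta})^{-1}A$ is doubly superstochastic.
   Context: For a positive integer $n$, $K_n$ denotes the set of all real $n\times n$ matrices with nonnegative entries whose entries have total sum $n$. For $A=(a_{ij})\in K_n$, let $r_i=\sum_{j=1}^n a_{ij}$ and $c_j=\sum_{i=1}^n a_{ij}$ be the row and column sums. The permanent is $\operatorname{per}(A)=\sum_{\sigma\in S_n}\prod_{i=1}^n a_{i,\sigma(i)}$, where $S_n$ is the symmetric group on $\{1,\dots,n\}$. The Dittert function is $$\phi(A)=\prod_{i=1}^n r_i+\prod_{j=1}^n c_j-\operatorname{per}(A).$$ $J_n$ is the $n\times n$ matrix with all entries equal to $1$, and $\gamma_n=n!/n^n$, so that $\phi(n^{-1}J_n)=2-\gamma_n$. (Under the hypothesis $\phi(A)\ge\phi(n^{-1}J_n)$ one has $\delta\ge 0$, so the square root is real.) A nonnegative $n\times n$ matrix $M$ is called doubly superstochastic if there exists an $n\times n$ doubly stochastic matrix $B$ (nonnegative entries, all row and column sums equal to $1$) such that $B\le M$ entrywise. *)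

(* Defs.v *)
(* MathComp world; the real numbers are an arbitrary R : realType. *)
From mathcomp Require Import all_boot all_order all_algebra perm.
From mathcomp Require Import reals.

Set Implicit Arguments.
Unset Strict Implicit.
Unset Printing Implicit Defensive.

Import Order.TTheory GRing.Theory Num.Theory.
Local Open Scope ring_scope.

Definition nonneg_mx (R : realType) (n : nat) (A : 'M[R]_n) : Prop :=
  forall i j, 0 <= A i j.

(* The set K_n, as a predicate. *)
Definition in_K (R : realType) (n : nat) (A : 'M[R]_n) : Prop :=
  nonneg_mx A /\ \sum_i \sum_j A i j = n%:R.

Definition row_sum (R : realType) (n : nat) (A : 'M[R]_n) (i : 'I_n) : R :=
  \sum_j A i j.

Definition col_sum (R : realType) (n : nat) (A : 'M[R]_n) (j : 'I_n) : R :=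
  \sum_i A i j.

Definition permanent (R : realType) (n : nat) (A : 'M[R]_n) : R :=
  \sum_(s : 'S_n) \prod_i A i (s i).

Definition dittert (R : realType) (n : nat) (A : 'M[R]_n) : R :=
  \prod_i row_sum A i + \prod_j col_sum A j - permanent A.

Definition all_ones (R : realType) (n : nat) : 'M[R]_n := const_mx 1.

Definition gamma (R : realType) (n : nat) : R := n`!%:R / n%:R ^+ n.

Definition doubly_stochastic (R : realType) (n : nat) (B : 'M[R]_n) : Prop :=
  [/\ nonneg_mx B,
      forall i, row_sum B i = 1
    & forall j, col_sum B j = 1].

Definition doubly_superstochastic (R : realType) (n : nat) (M : 'M[R]_n) :
    Prop :=
  nonneg_mx M /\
  exists2 B : 'M[R]_n, doubly_stochastic B & forall i j, B i j <= M i j.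

(* Main.v *)
(* Since prod r and prod c are at most 1, the hypothesis on phi(A) gives
   (1 - prod r) + (1 - prod c) <= delta.  A Hellinger-type estimate
   (Cauchy-Schwarz applied to 1 - r_i = (1 - sqrt r_i) (1 + sqrt r_i), then
   AM-GM on the sqrt r_i) turns this into
     sum_(i in I) (1 - r_i) + sum_(j in J) (1 - c_j) <= sqrt (3 n delta)
   for all I and J, hence the sum of A over I x J is at least
   (1 - sqrt (3 n delta)) (|I| + |J| - n).  By the theorem of Cruse, Fulkerson
   and Mirsky this is enough: lower the entries of the rescaled matrix one
   after the other as long as all these cut inequalities survive; at the end
   every positive entry lies in a tight I x J, and uncrossing the tight pairs
   shows that all row and column sums are 1. *)
Require Import Defs.
From mathcomp Require Import all_boot all_order all_algebra.
From mathcomp Require Import reals.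
From mathcomp Require Import perm ring lra.

Import Order.TTheory GRing.Theory Num.Theory.
Local Open Scope ring_scope.

Set Implicit Arguments.
Unset Strict Implicit.

(** * Product and deviations of a nonnegative vector of sum n *)

(** Lagrange's identity: the double sum of squares in [h] is twice the gap. *)
Lemma sqr_sum_mul_le (R : realDomainType) (I : finType) (a b : I -> R) :
  (\sum_i a i * b i) ^+ 2 <= (\sum_i a i ^+ 2) * (\sum_i b i ^+ 2).
Proof.
have h : 0 <= \sum_i \sum_j (a i * b j - a j * b i) ^+ 2.
  by apply: sumr_ge0 => i _; apply: sumr_ge0 => j _; exact: sqr_ge0.
have e1 : (\sum_i a i ^+ 2) * (\sum_i b i ^+ 2) =
  \sum_i \sum_j a i ^+ 2 * b j ^+ 2 by rewrite big_distrlr.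
have e2 : (\sum_i a i ^+ 2) * (\sum_i b i ^+ 2) =
  \sum_i \sum_j a j ^+ 2 * b i ^+ 2 by rewrite e1 exchange_big.
have e3 : (\sum_i a i * b i) ^+ 2 =
  \sum_i \sum_j (a i * b i) * (a j * b j) by rewrite expr2 big_distrlr.
suff e : \sum_i \sum_j (a i * b j - a j * b i) ^+ 2 =
  2 * ((\sum_i a i ^+ 2) * (\sum_i b i ^+ 2) - (\sum_i a i * b i) ^+ 2).
  by move: h; rewrite e pmulr_rge0 // subr_ge0.
rewrite mulrBr [2 * (_ * _)]mulrDl !mul1r {1}e1 e2 e3 mulr_sumr.
rewrite -big_split -sumrB.
apply: eq_bigr => i _; rewrite mulr_sumr -big_split -sumrB.
by apply: eq_bigr => j _ /=; ring.
Qed.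

(** Induction works because (1 - u)(1 + (m+1)u) = 1 + mu - (m+1)u^2. *)
Lemma exprBn_mul_le1 (R : realDomainType) (u : R) (m : nat) :
  0 <= u <= 1 -> (1 - u) ^+ m * (1 + m%:R * u) <= 1.
Proof.
case/andP=> u0 u1; elim: m => [|m IHm]; first by rewrite expr0 mul0r addr0 mulr1.
apply: le_trans IHm; rewrite exprSr -mulrA ler_wpM2l ?exprn_ge0 ?subr_ge0 //.
rewrite -natr1; have m0 : 0 <= m%:R :> R := ler0n _ _.
have := mulr_ge0 m0 (mulr_ge0 u0 u0); nra.
Qed.

Lemma prod_deviation (R : realType) (n : nat) (r : 'I_n -> R) (I : {set 'I_n}) :
  (0 < n)%N -> (forall i, 0 <= r i) -> \sum_i r i = n%:R ->
  (\prod_i r i) * (1 + (\sum_(i in I) (1 - r i)) ^+ 2 / n%:R) <= 1.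
Proof.
move=> n_gt0 r0 rn; set e := \sum_(i in I) _.
have nR0 : 0 < n%:R :> R by rewrite ltr0n.
have nN0 : n%:R != 0 :> R by rewrite gt_eqF.
pose S := \sum_i Num.sqrt (r i).
have S0 : 0 <= S by apply: sumr_ge0 => i _; exact: sqrtr_ge0.
have sum1 : \sum_(i < n) (1 : R) = n%:R by rewrite sumr_const card_ord.
have e2 : e ^+ 2 <= n%:R ^+ 2 - S ^+ 2.
  (* Signs s_i for which 2 e = sum_i s_i (1 - r_i). *)
  pose s i : R := if i \in I then 1 else -1.
  have ss i : s i ^+ 2 = 1 by rewrite /s; case: ifP; rewrite ?sqrrN expr1n.
  have eI : \sum_(i | i \notin I) (1 - r i) = - e.
    apply/eqP; rewrite -subr_eq0 opprK addrC -(bigID (mem I) predT) /=.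
    by rewrite sumrB sum1 rn subrr.
  have e2E : 2 * e = \sum_i (s i * (1 - Num.sqrt (r i))) * (1 + Num.sqrt (r i)).
    rewrite (bigID (mem I)) /=.
    rewrite (eq_bigr (fun i => 1 - r i)); last first.
      move=> i iI; rewrite /s iI mul1r; move: (sqr_sqrtr (r0 i)) => h.
      by rewrite -[in RHS]h; ring.
    rewrite [X in _ + X](eq_bigr (fun i => - (1 - r i))); last first.
      move=> i iI; rewrite /s (negPf iI) mulN1r; move: (sqr_sqrtr (r0 i)) => h.
      by rewrite -[in RHS]h; ring.
    by rewrite sumrN -/e eI; ring.
  (* The two sums of squares are 2n - 2S and 2n + 2S, so Cauchy-Schwarz reads 4 e^2 <= 4 (n^2 -
     S^2). *)
  have := @sqr_sum_mul_le R _ (fun i => s i * (1 - Num.sqrt (r i)))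
            (fun i => 1 + Num.sqrt (r i)).
  rewrite -e2E.
  have -> : \sum_i (s i * (1 - Num.sqrt (r i))) ^+ 2 = 2 * n%:R - 2 * S.
    transitivity (\sum_i (1 + r i - 2 * Num.sqrt (r i))).
      apply: eq_bigr => i _; rewrite exprMn ss mul1r; have := sqr_sqrtr (r0 i).
      by set q := Num.sqrt _ => <-; ring.
    rewrite sumrB big_split /= sum1 rn -mulr_sumr -/S; ring.
  have -> : \sum_i (1 + Num.sqrt (r i)) ^+ 2 = 2 * n%:R + 2 * S.
    transitivity (\sum_i (1 + r i + 2 * Num.sqrt (r i))).
      apply: eq_bigr => i _; have := sqr_sqrtr (r0 i); set q := Num.sqrt _ => <-; ring.
    rewrite !big_split /= sum1 rn -mulr_sumr -/S; ring.
  nra.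
(* Scaled so that AM-GM gives prod r <= (S/n)^(2n) <= (1 - u)^n, while e^2/n = n u fits
   [exprBn_mul_le1]. *)
pose u := e ^+ 2 / n%:R ^+ 2.
have u0 : 0 <= u by rewrite divr_ge0 ?sqr_ge0.
have Su : (S / n%:R) ^+ 2 <= 1 - u.
  rewrite expr_div_n lerBrDr -mulrDl ler_pdivrMr ?exprn_gt0 // mul1r; lra.
have u1 : u <= 1 by rewrite -subr_ge0; apply: le_trans Su; exact: sqr_ge0.
have prodle : \prod_i r i <= (1 - u) ^+ n.
  have -> : \prod_i r i = (\prod_i Num.sqrt (r i)) ^+ 2.
    by rewrite -prodrXl; apply: eq_bigr => i _; rewrite sqr_sqrtr.
  have agm : \prod_i Num.sqrt (r i) <= (S / n%:R) ^+ n.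
    have := @leif_AGM R _ predT (fun i => Num.sqrt (r i)) (fun i _ => sqrtr_ge0 _).
    by rewrite cardT size_enum_ord => -[].
  apply: (@le_trans _ _ (((S / n%:R) ^+ n) ^+ 2)).
    rewrite lerXn2r // nnegrE ?exprn_ge0 ?divr_ge0 //.
    by apply: prodr_ge0 => i _; exact: sqrtr_ge0.
  rewrite -exprM mulnC exprM lerXn2r // nnegrE ?sqr_ge0 ?subr_ge0 //.
have -> : e ^+ 2 / n%:R = n%:R * u by rewrite /u; field.
apply: le_trans (@exprBn_mul_le1 _ u n _); last by rewrite u0 u1.
by rewrite ler_wpM2r // addr_ge0 // mulr_ge0.
Qed.

(** * Cut inequalities and doubly superstochastic matrices *)

(** For a doubly stochastic matrix this is the mass on the complementary rows and columns, hence
    nonnegative. *)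
Definition slack {R : realType} {n : nat} (A : 'M[R]_n)
    (P : {set 'I_n} * {set 'I_n}) : R :=
  \sum_(i in P.1) \sum_(j in P.2) A i j + n%:R - #|P.1|%:R - #|P.2|%:R.

Definition slack_nonneg {R : realType} {n : nat} (A : 'M[R]_n) : Prop :=
  forall P, 0 <= slack A P.

(** The two obstructions to lowering an entry: its own nonnegativity, or a cut through it that has
    no slack left. *)
Definition tight_at {R : realType} {n : nat} (A : 'M[R]_n) (p : 'I_n * 'I_n) :
    Prop :=
  A p.1 p.2 = 0 \/
  exists P : {set 'I_n} * {set 'I_n}, [/\ p.1 \in P.1, p.2 \in P.2 & slack A P = 0].

Section Slack.
Variables (R : realType) (n : nat).
Implicit Types (A B : 'M[R]_n) (I J K L : {set 'I_n}).

Lemma slack_le A B (P : {set 'I_n} * {set 'I_n}) :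
  (forall i j, A i j <= B i j) -> slack A P <= slack B P.
Proof.
move=> AB; rewrite /slack -!addrA lerD2r.
by apply: ler_sum => i _; apply: ler_sum => j _.
Qed.

Lemma slack_lower_entry A (p : 'I_n * 'I_n) (t : R)
    (P : {set 'I_n} * {set 'I_n}) :
  slack (A - t *: delta_mx p.1 p.2) P =
  slack A P - (if (p.1 \in P.1) && (p.2 \in P.2) then t else 0).
Proof.
rewrite /slack.
have -> : \sum_(i in P.1) \sum_(j in P.2) (A - t *: delta_mx p.1 p.2) i j =
  \sum_(i in P.1) \sum_(j in P.2) A i j
  - \sum_(i in P.1) \sum_(j in P.2) t * ((i == p.1) && (j == p.2))%:R.
  rewrite -sumrB; apply: eq_bigr => i _; rewrite -sumrB; apply: eq_bigr => j _.
  by rewrite !mxE.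
suff -> : \sum_(i in P.1) \sum_(j in P.2) t * ((i == p.1) && (j == p.2))%:R =
  if (p.1 \in P.1) && (p.2 \in P.2) then t else 0 by ring.
rewrite pair_big /= big_mkcond (bigD1 p) //= !eqxx mulr1 big1 ?addr0 //.
case: p => a b [i j]; rewrite xpair_eqE /= => /negPf ->.
by rewrite mulr0 if_same.
Qed.

(** Entries are treated one at a time. Those already tight stay so, since lowering never increases
    an entry or a slack and both remain nonnegative. *)
Lemma exists_tight_below A (s : seq ('I_n * 'I_n)) :
  nonneg_mx A -> slack_nonneg A ->
  exists B : 'M[R]_n, [/\ nonneg_mx B, slack_nonneg B,
    forall i j, B i j <= A i j & {in s, forall p, tight_at B p}].
Proof.
move=> A0 sA; elim: s => [|p s [B [B0 sB BA tB]]]; first by exists A.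
pose Q (P : {set 'I_n} * {set 'I_n}) := (p.1 \in P.1) && (p.2 \in P.2).
pose Pm := [arg min_(P < (setT, setT) | Q P) slack B P]%O.
have [Pm_in Pm_min] : Q Pm /\ forall P, Q P -> slack B Pm <= slack B P.
  by rewrite /Pm; case: arg_minP => [|P QP minP]; rewrite /Q ?inE.
(* The largest amount by which the entry p can be lowered. *)
pose t := Num.min (B p.1 p.2) (slack B Pm).
have t0 : 0 <= t by rewrite le_min B0 sB.
have tB1 : t <= B p.1 p.2 by rewrite ge_min lexx.
have tB2 : t <= slack B Pm by rewrite ge_min lexx orbT.
pose C := B - t *: delta_mx p.1 p.2.
have CE i j : C i j = B i j - t * ((i == p.1) && (j == p.2))%:R by rewrite !mxE.
have C0 : nonneg_mx C.
  move=> i j; rewrite CE; case: eqP => [->|] /=; last by rewrite mulr0 subr0.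
  by case: eqP => [->|] /=; rewrite ?mulr1 ?subr_ge0 ?mulr0 ?subr0.
have CB i j : C i j <= B i j by rewrite CE gerBl mulr_ge0.
have sC : slack_nonneg C.
  move=> P; rewrite slack_lower_entry; case: ifP => [QP|_]; last by rewrite subr0.
  by rewrite subr_ge0; apply: le_trans tB2 _; apply: Pm_min.
exists C; split=> // [i j|q]; first exact: le_trans (CB i j) (BA i j).
rewrite inE => /orP[/eqP->|/tB [Bq|[P [P1 P2 sP]]]].
(* Whichever term attains the minimum [t] becomes 0 in [C]. *)
- have [le|lt] := leP (B p.1 p.2) (slack B Pm).
    by left; rewrite CE !eqxx mulr1 /t (min_idPl le) subrr.
  right; exists Pm; case/andP: (Pm_in) => P1 P2; split=> //.
  by rewrite slack_lower_entry -/(Q Pm) Pm_in /t (min_idPr (ltW lt)) subrr.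
- by left; apply/eqP; rewrite eq_le C0 andbT -Bq CB.
- right; exists P; split=> //.
  by apply/eqP; rewrite eq_le sC andbT -sP slack_le.
Qed.

(* Slack is submodular for the lattice order in which column sets are reversed. *)
Lemma slack_submod A I J K L : nonneg_mx A ->
  slack A (I :&: K, J :|: L) + slack A (I :|: K, J :&: L) <=
  slack A (I, J) + slack A (K, L).
Proof.
move=> A0.
(* The cardinality terms are modular, so only the masses on the rectangles matter. *)
have cI : #|I :&: K|%:R + #|I :|: K|%:R = #|I|%:R + #|K|%:R :> R.
  by rewrite -!natrD addnC cardsUI.
have cJ : #|J :&: L|%:R + #|J :|: L|%:R = #|J|%:R + #|L|%:R :> R.
  by rewrite -!natrD addnC cardsUI.
pose g (X Y : {set 'I_n}) := \sum_(i in X) \sum_(j in Y) A i j.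
suff : g (I :&: K) (J :|: L) + g (I :|: K) (J :&: L) <= g I J + g K L.
  by rewrite /slack /= -!/(g _ _); lra.
have gE X Y : g X Y = \sum_i \sum_j (if (i \in X) && (j \in Y) then A i j else 0).
  rewrite /g big_mkcond; apply: eq_bigr => i _; case: (i \in X) => /=.
    by rewrite big_mkcond.
  by rewrite big1.
rewrite !gE -!big_split; apply: ler_sum => i _; rewrite -!big_split.
apply: ler_sum => j _ /=; have := A0 i j; rewrite !inE.
by case: (i \in I); case: (i \in K); case: (j \in J); case: (j \in L) => /= ?; lra.
Qed.

Lemma row_sum_le1 A i : nonneg_mx A -> slack_nonneg A ->
  (forall p, tight_at A p) -> row_sum A i <= 1.
Proof.
move=> A0 sA tA.
(* Uncrossing the tight pairs of the entries of row i yields one tight pair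
   whose column set covers the support of that row. *)
have [P [iP suppP sP]] : exists P : {set 'I_n} * {set 'I_n},
    [/\ i \in P.1, {in enum 'I_n, forall j, A i j != 0 -> j \in P.2} & slack A P = 0].
  elim: (enum 'I_n) => [|j s [P [iP suppP sP]]].
    (* All rows against no column: the slack is 0 + n - n - 0. *)
    exists (setT, set0); split=> //=; first by rewrite inE.
    rewrite /slack /= cards0 cardsT card_ord big1 ?add0r ?subr0 ?subrr // => k _.
    by rewrite big_set0.
  have [Aij|[P' [/= iP' jP' sP']]] := tA (i, j).
    exists P; split=> // k; rewrite inE => /orP[/eqP->|]; last exact: suppP.
    by rewrite Aij eqxx.
  exists (P.1 :&: P'.1, P.2 :|: P'.2); split=> /=; first by rewrite inE iP.
    move=> k; rewrite !inE => /orP[/eqP->|ks Aik]; first by rewrite jP' orbT.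
    by rewrite suppP.
  (* Two nonnegative slacks with sum at most 0 both vanish. *)
  have := slack_submod P.1 P.2 P'.1 P'.2 A0; rewrite -!surjective_pairing sP sP'.
  have := sA (P.1 :&: P'.1, P.2 :|: P'.2); have := sA (P.1 :|: P'.1, P.2 :&: P'.2).
  lra.
(* Deleting row [i] from the tight pair leaves slack [1 - row_sum A i], as [P.2] covers the support
   of that row. *)
have := sA (P.1 :\ i, P.2); move: sP.
rewrite /slack /= (big_setD1 i) //= (cardsD1 i P.1) iP /= natrD.
have -> : \sum_(j in P.2) A i j = row_sum A i.
  rewrite /row_sum big_mkcond; apply: eq_bigr => j _; case: ifPn => // /negP jP.
  by apply/esym/eqP/negPn/negP => /suppP; rewrite mem_enum => /(_ isT).
lra.
Qed.

(** This is the cut of one row against all columns. *)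
Lemma row_sum_ge1 A i : slack_nonneg A -> 1 <= row_sum A i.
Proof.
move/(_ ([set i], setT)); rewrite /slack /= big_set1 cards1 cardsT card_ord.
by rewrite (eq_bigl predT) => [|j]; rewrite ?inE // -/(row_sum A i); lra.
Qed.

Lemma slack_tr A (P : {set 'I_n} * {set 'I_n}) : slack A^T P = slack A (P.2, P.1).
Proof.
rewrite /slack /= exchange_big /=.
under eq_bigr do under eq_bigr do rewrite mxE.
by lra.
Qed.

Lemma superstochastic_of_slack A : nonneg_mx A -> slack_nonneg A ->
  doubly_superstochastic A.
Proof.
move=> A0 sA; split=> //.
have [B [B0 sB BA tB]] := exists_tight_below (enum {: 'I_n * 'I_n}) A0 sA.
have {}tB p : tight_at B p by apply: tB; rewrite mem_enum.
exists B => //; split=> // i.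
  by apply/eqP; rewrite eq_le row_sum_le1 //= row_sum_ge1.
(* Column sums follow from the row case: slack and tightness are preserved by transposition. *)
have colE : col_sum B i = row_sum B^T i by apply: eq_bigr => j _; rewrite mxE.
have sBT : slack_nonneg B^T by move=> P; rewrite slack_tr.
rewrite colE; apply/eqP; rewrite eq_le row_sum_ge1 // andbT row_sum_le1 //.
  by move=> j k; rewrite mxE.
move=> [j k]; have [/= e|[P /= [P1 P2 sP]]] := tB (k, j); first by left; rewrite mxE.
by right; exists (P.2, P.1); rewrite slack_tr -surjective_pairing.
Qed.

End Slack.

(** * From the Dittert bound to the cut inequalities *)

Lemma dittert_scaled_all_ones (R : realType) (n : nat) : (0 < n)%N ->
  dittert (n%:R^-1 *: all_ones R n) = 2 - gamma R n.
Proof.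
move=> n_gt0; have nN0 : n%:R != 0 :> R by rewrite pnatr_eq0 -lt0n.
have E i j : (n%:R^-1 *: all_ones R n) i j = n%:R^-1 by rewrite !mxE mulr1.
have rE i : row_sum (n%:R^-1 *: all_ones R n) i = 1.
  rewrite /row_sum; under eq_bigr do rewrite E.
  by rewrite sumr_const card_ord -[_^-1 *+ n]mulr_natr mulVf.
have cE i : col_sum (n%:R^-1 *: all_ones R n) i = 1.
  rewrite /col_sum; under eq_bigr do rewrite E.
  by rewrite sumr_const card_ord -[_^-1 *+ n]mulr_natr mulVf.
rewrite /dittert /permanent (eq_bigr _ (fun i _ => rE i)) big1_eq.
rewrite (eq_bigr _ (fun j _ => cE j)) big1_eq; congr (_ - _).
rewrite (eq_bigr (fun=> n%:R^-1 ^+ n)) => [|s _].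
  by rewrite sumr_const card_Sn -[_ ^+ n *+ _]mulr_natl exprVn.
by under eq_bigr do rewrite E; rewrite prodr_const card_ord.
Qed.

(** Submodularity applied to (I, J) and the pair of full sets, whose slack is 0; the pairs (I, all)
    and (all, J) have as slack minus the two deviations. *)
Lemma slack_ge (R : realType) (n : nat) (A : 'M[R]_n) : in_K A ->
  forall P : {set 'I_n} * {set 'I_n},
  - \sum_(i in P.1) (1 - row_sum A i) - \sum_(j in P.2) (1 - col_sum A j) <=
  slack A P.
Proof.
move=> [A0 An] [I J] /=.
have inT (f : 'I_n -> R) : \sum_(i in [set: 'I_n]) f i = \sum_i f i.
  by apply: eq_bigl => i; rewrite inE.
have rowE X : \sum_(i in X) \sum_(j in [set: 'I_n]) A i j =
    \sum_(i in X) row_sum A i by apply: eq_bigr => i _; exact: inT.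
have colE : \sum_(i in [set: 'I_n]) \sum_(j in J) A i j =
    \sum_(j in J) col_sum A j.
  by rewrite exchange_big; apply: eq_bigr => j _; exact: inT.
have := slack_submod setT setT I J A0.
rewrite !setTI !setTU /slack /= colE !rowE inT [X in _ <= X + _ - _ - _ + _]An.
by rewrite !cardsT !card_ord !sumrB !sumr_const; lra.
Qed.

(** With p the product and v = e^2/n, [prod_deviation] gives p v <= 1 - p, so v <= 4/3 (1 - p). The
    weaker 3/2 yields the constant 3 once rows and columns are combined. *)
Lemma sqr_deviation_le (R : realType) (n : nat) (r : 'I_n -> R) (I : {set 'I_n}) :
  (0 < n)%N -> (forall i, 0 <= r i) -> \sum_i r i = n%:R ->
  3 / 4 <= \prod_i r i ->
  (\sum_(i in I) (1 - r i)) ^+ 2 <= 3 / 2 * n%:R * (1 - \prod_i r i).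
Proof.
move=> n_gt0 r0 rn p34; have := prod_deviation I n_gt0 r0 rn.
have nR0 : 0 < n%:R :> R by rewrite ltr0n.
set p := \prod_i r i in p34 *; set e := \sum_(i in I) _ => h.
rewrite mulrAC -ler_pdivrMr //; have : 0 <= e ^+ 2 / n%:R by rewrite divr_ge0 ?sqr_ge0 ?ltW.
move: h; set v := e ^+ 2 / n%:R; nra.
Qed.

Lemma prod_le1 (R : realType) (n : nat) (r : 'I_n -> R) :
  (0 < n)%N -> (forall i, 0 <= r i) -> \sum_i r i = n%:R -> \prod_i r i <= 1.
Proof.
move=> n_gt0 r0 rn; have := prod_deviation set0 n_gt0 r0 rn.
by rewrite big_set0 expr0n mul0r addr0 mulr1.
Qed.

Unset Implicit Arguments.

Theorem lemma4 (R : realType) (n : nat) (hn : (0 < n)%N) (A : 'M[R]_n)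
  (hA : in_K A)
  (hphi : dittert (n%:R^-1 *: all_ones R n) <= dittert A)
  (delta : R) (hdelta : delta = gamma R n - permanent A)
  (hsmall : delta < Num.min (1 / 4) (1 / (3 * n%:R))) :
  doubly_superstochastic ((1 - Num.sqrt (3 * n%:R * delta))^-1 *: A).
Proof.
have [A0 An] := hA.
have nR0 : 0 < n%:R :> R by rewrite ltr0n.
have r0 i : 0 <= row_sum A i by apply: sumr_ge0 => j _; apply: A0.
have c0 j : 0 <= col_sum A j by apply: sumr_ge0 => i _; apply: A0.
have cn : \sum_j col_sum A j = n%:R by rewrite -An exchange_big.
have pr1 := prod_le1 hn r0 An.
have pc1 := prod_le1 hn c0 cn.
have sum_ge : 2 - delta <= \prod_i row_sum A i + \prod_j col_sum A j.
  by move: hphi; rewrite dittert_scaled_all_ones // /dittert; lra.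
move: hsmall; rewrite lt_min !ltr_pdivlMr ?mulr_gt0 // => /andP[d14 dn].
have d0 : 0 <= delta by lra.
set s := Num.sqrt _.
have s2 : s ^+ 2 = 3 * n%:R * delta by rewrite sqr_sqrtr // !mulr_ge0 // ltW.
have s0 : 0 <= s := sqrtr_ge0 _.
have s1 : s < 1.
  rewrite -(ltr_pXn2r (n := 2)) ?nnegrE ?ler01 //.
  by rewrite expr1n s2 mulrC.
have dev (I J : {set 'I_n}) :
    \sum_(i in I) (1 - row_sum A i) + \sum_(j in J) (1 - col_sum A j) <= s.
  (* The other product is at most 1 and delta < 1/4. *)
  have pr34 : 3 / 4 <= \prod_i row_sum A i by lra.
  have pc34 : 3 / 4 <= \prod_i col_sum A i by lra.
  have := sqr_deviation_le I hn r0 An pr34.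
  have := sqr_deviation_le J hn c0 cn pc34.
  move: (\sum_(i in I) _) (\sum_(j in J) _) => er ec hc hr.
  apply: le_trans (ler_norm _) _; rewrite -(ler_pXn2r (n := 2)) ?nnegrE //.
  (* Uses (er + ec)^2 <= 2 (er^2 + ec^2). *)
  have := ler_wpM2l (ltW nR0) sum_ge; have := sqr_ge0 (er - ec).
  rewrite real_normK ?num_real // s2; nra.
apply: superstochastic_of_slack => [i j|P].
  by rewrite mxE; apply: mulr_ge0 (A0 i j); rewrite invr_ge0 subr_ge0 ltW.
have := slack_ge hA P; have := dev P.1 P.2; rewrite /slack.
have -> : \sum_(i in P.1) \sum_(j in P.2) ((1 - s)^-1 *: A) i j =
    (1 - s)^-1 * \sum_(i in P.1) \sum_(j in P.2) A i j.
  rewrite mulr_sumr; apply: eq_bigr => i _; rewrite mulr_sumr.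
  by apply: eq_bigr => j _; rewrite mxE.
set m := \sum_(i in P.1) \sum_(j in P.2) A i j => h1 h2.
have m0 : 0 <= m by apply: sumr_ge0 => i _; apply: sumr_ge0 => j _; apply: A0.
have s1' : 0 < 1 - s by rewrite subr_gt0.
suff : (1 - s) * (#|P.1|%:R + #|P.2|%:R - n%:R) <= m.
  by rewrite -ler_pdivlMl //; lra.
(* Let k = |I| + |J| - n. If k <= 0 the left side is nonpositive; otherwise k >= 1 by integrality,
   and m >= k - s >= (1 - s) k. *)
have [le|lt] := leqP (#|P.1| + #|P.2|) n.
  by move: le; rewrite -(ler_nat R) natrD; nra.
by move: lt; rewrite -(ler_nat R) -natr1 natrD; nra.
Qed.
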